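(* Let $(\mathfrak h,(h_i)_{i\in I},(\alpha_i)_{i\in I})$, $I=\{1,\dots,n\}$, be a root base of a linear Coxeter system, and let $L_{\mathfrak h}=\{r\in\mathbb R^n\mid r_1h_1+\cdots+r_nh_n=0\}$. For $J\subseteq I$ the following are equivalent: (i) $J$ is facial. (ii) For every element $r\in L_{\mathfrak h}$ either both $I_+(r)\subseteq J$ and $I_-(r)\subseteq J$, or both $I_+(r)\not\subseteq J$ and $I_-(r)\not\subseteq J$. (iii) For all $r\in L_{\mathfrak h}$ the following holds: if $I_+(r)\subseteq J$ then also $I_-(r)\subseteq J$. (iv) For all $r\in L_{\mathfrak h}$ the following holds: if $I_-(r)\subseteq J$ then also $I_+(r)\subseteq J$.
   Context: $\mathbb R^+_0=[0,\infty)$, $n\ge 1$. A real matrix $A=(a_{ij})_{i,j\in I}$ is called a generalized Cartan matrix if: (a) for all $i\ne j$ the entries $a_{ij},a_{ji}$ are either both strictly negative or both zero; (b) $a_{ii}=2$ for all $i$, and for all $i\neq j$ with $a_{ij}a_{ji}<4$ one has $a_{ij}a_{ji}=4\cos^2(\pi/m_{ij})$ for some integer $m_{ij}\ge 2$. A root base of a linear Coxeter system $(\mathfrak h,(h_i)_{i\in I},(\alpha_i)_{i\in I})$ consists of a finite-dimensional real vector space $\mathfrak h$, elements $h_1,\dots,h_n\in\mathfrak h$ and $\alpha_1,\dots,\alpha_n\in\mathfrak h^*$ such that $A=(a_{ij})$ with $a_{ij}=\alpha_j(h_i)$ is a generalized Cartan matrix and $L_{\mathfrak h}\cap(\mathbb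 R_0^+)^n=\{0\}$. A face of a convex cone $K$ containing $0$ is a convex cone $F\subseteq K$ with $(K\setminus F)+K\subseteq K\setminus F$. A set $J\subseteq I$ is called facial if $\sum_{j\in J}\mathbb R_0^+h_j$ is a face of $\sum_{i\in I}\mathbb R_0^+h_i$ (the empty sum is $\{0\}$). For $r\in\mathbb R^n$: $I_+(r)=\{i\in I\mid r_i>0\}$ and $I_-(r)=\{i\in I\mid r_i<0\}$. *)

(* Defs.v *)
From HB Require Import structures.
From mathcomp Require Import all_boot all_order all_algebra.
From mathcomp Require Import unstable mathcomp_extra boolp classical_sets reals.
From mathcomp Require Import interval_inference trigo convex.

Set Implicit Arguments.
Unset Strict Implicit.
Unset Printing Implicit Defensive.

Import Order.TTheory GRing.Theory Num.Theory.

Local Open Scope classical_set_scope.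
Local Open Scope ring_scope.

Section Defs.
Context {R : realType}.

Definition generalized_cartan n (A : 'M[R]_n) : Prop :=
  [/\ forall i j, i != j -> (A i j < 0 /\ A j i < 0) \/ (A i j = 0 /\ A j i = 0),
      forall i, A i i = 2
    & forall i j, i != j -> A i j * A j i < 4 ->
        exists2 m : nat, (2 <= m)%N & A i j * A j i = 4 * cos (pi / m%:R) ^+ 2].

Definition nneg_orthant {n} : set 'rV[R]_n := [set c | forall i, 0 <= c ord0 i].

Context {H : vectType R}.

Definition relations n (h : 'I_n -> H) : set 'rV[R]_n :=
  [set r | \sum_i r ord0 i *: h i = 0].

(* The dual space of H is 'Hom(H, R^o). *)
Record root_base n (h : 'I_n -> H) (alpha : 'I_n -> 'Hom(H, R^o)) : Prop :=
  RootBase {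
    root_base_cartan : generalized_cartan (\matrix_(i, j) (alpha j (h i) : R));
    root_base_relations : relations h `&` nneg_orthant = [set 0] }.

(* A convex cone is stable under scaling by positive reals, so it need not
   contain 0. *)
Definition convex_cone (C : set H) : Prop :=
  convex_set C /\ forall (t : R) x, 0 < t -> C x -> C (t *: x).

(* Only meaningful when K is a convex cone containing 0. *)
Definition is_face (K F : set H) : Prop :=
  [/\ convex_cone F, F `<=` K
    & [set x + y | x in K `\` F & y in K] `<=` K `\` F].

(* Coordinates of c outside J are irrelevant; for J = set0 this is [set 0]. *)
Definition cone_span n (h : 'I_n -> H) (J : {set 'I_n}) : set H :=
  [set \sum_(j in J) c ord0 j *: h j | c in nneg_orthant].

Definition facial n (h : 'I_n -> H) (J : {set 'I_n}) : Prop :=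
  is_face (cone_span h [set: 'I_n]%SET) (cone_span h J).

Definition pos_supp n (r : 'rV[R]_n) : {set 'I_n} := [set i | 0 < r ord0 i]%SET.

Definition neg_supp n (r : 'rV[R]_n) : {set 'I_n} := [set i | r ord0 i < 0]%SET.

(* is_face is only applied to such K. *)
Lemma cone_span_convex_cone n (h : 'I_n -> H) (J : {set 'I_n}) :
  convex_cone (cone_span h J) /\ cone_span h J 0.
Proof.
split; last first.
  exists 0; first by move=> i; rewrite mxE.
  by rewrite big1 // => j _; rewrite mxE scale0r.
split; last first.
  move=> t _ t0 [c c0 <-]; exists (t *: c).
    by move=> i; rewrite mxE mulr_ge0// ltW.
  by rewrite scaler_sumr; apply: eq_bigr => j _; rewrite mxE scalerA.
move=> x y t /[!inE] -[c c0 <-] [d d0 <-].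
exists (t%:num *: c + onem t%:num *: d).
  by move=> i; rewrite !mxE addr_ge0// mulr_ge0// onem_ge0.
rewrite [RHS]/conv /= !scaler_sumr -big_split; apply: eq_bigr => j _.
by rewrite !mxE scalerDl !scalerA.
Qed.

End Defs.

(* Main.v *)
Require Import Defs.
From mathcomp Require Import all_boot all_order all_algebra.
From mathcomp Require Import boolp classical_sets reals.

(**
  A relation r with I_+(r) contained in J writes the positive part of r, a
  point of the cone of J, as a nonnegative combination of the h_i with i in
  I_-(r); if J is facial, each such h_i lies in the cone of J.  If i were not in
  J, applying alpha_i to h_i = sum_J c_j h_j would give 2 on the left and, the
  off-diagonal entries of A being nonpositive, at most 0 on the right.
  Conversely, a point x + y of the cone of J with x, y in the full cone gives a
  relation whose negative support lies in J; by (iv) the coefficients of x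
  vanish outside J.
*)

Import Order.TTheory GRing.Theory Num.Theory.

Local Open Scope ring_scope.
Local Open Scope classical_set_scope.

Section Cones.
Context {R : realType} {H : vectType R} {n : nat}.
Implicit Types (h : 'I_n -> H) (J : {set 'I_n}) (r : 'rV[R]_n).

(** Coefficients become functions on all of ['I_n] that vanish off [J], so that combinations coming
    from different index sets can be added and compared termwise. *)
Lemma cone_spanP h J x :
  cone_span h J x <->
  exists c : 'I_n -> R,
    [/\ forall i, 0 <= c i, forall i, i \notin J -> c i = 0
      & x = \sum_i c i *: h i].
Proof.
split=> [[c c0 <-]|[c [c0 cJ ->]]].
  exists (fun i => if i \in J then c ord0 i else 0); split.
  - by move=> i; case: ifP.
  - by move=> i /negbTE ->.
  - by rewrite big_mkcond; apply: eq_bigr => i _; case: ifP; rewrite ?scale0r.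
exists (\row_i c i); first by move=> i; rewrite mxE.
rewrite big_mkcond; apply: eq_bigr => i _; rewrite mxE.
by case: ifPn => // /cJ ->; rewrite scale0r.
Qed.

Lemma cone_span_setT h J x : cone_span h J x -> cone_span h [set: 'I_n]%SET x.
Proof.
move=> /cone_spanP[c [c0 _ xE]]; apply/cone_spanP; exists c; split=> // i.
by rewrite inE.
Qed.

Lemma cone_spanD h J x y :
  cone_span h J x -> cone_span h J y -> cone_span h J (x + y).
Proof.
move=> /cone_spanP[c [c0 cJ ->]] /cone_spanP[d [d0 dJ ->]]; apply/cone_spanP.
exists (fun i => c i + d i); split=> [i|i iJ|]; first exact: addr_ge0.
  by rewrite cJ// dJ// addr0.
by rewrite -big_split; apply: eq_bigr => i _; rewrite scalerDl.
Qed.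

(** The span of [J] is already a convex cone inside the full one, and the full cone is closed under
    addition; what remains of the face condition is its contrapositive. *)
Lemma facialP h J :
  facial h J <-> forall x y, cone_span h [set: 'I_n]%SET x ->
    cone_span h [set: 'I_n]%SET y -> cone_span h J (x + y) -> cone_span h J x.
Proof.
split=> [[_ _ KFK] x y Kx Ky Fxy|face].
  apply: contrapT => Fx.
  by have [] : (cone_span h [set: 'I_n]%SET `\` cone_span h J) (x + y);
    first by apply: KFK; exists x => //; exists y.
split; first exact: (cone_span_convex_cone h J).1.
  exact: cone_span_setT.
move=> _ [x [Kx nFx] [y Ky <-]]; split; first exact: cone_spanD.
by move=> /(face _ _ Kx Ky).
Qed.

Lemma relationsN h r : relations h r -> relations h (- r).
Proof.
rewrite /relations /= => r0; rewrite -[RHS]oppr0 -[in RHS]r0 -sumrN.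
by apply: eq_bigr => i _; rewrite mxE scaleNr.
Qed.

Lemma pos_suppN r : pos_supp (- r) = neg_supp r.
Proof. by apply/setP => i; rewrite !inE mxE oppr_gt0. Qed.

Lemma neg_suppN r : neg_supp (- r) = pos_supp r.
Proof. by apply/setP => i; rewrite !inE mxE oppr_lt0. Qed.

(** The factor [t] is there because the face property will yield [- r ord0 i *: h i] rather than
    [h i] itself. *)
Lemma root_base_notin_cone_span h (alpha : 'I_n -> 'Hom(H, R^o)) J i t :
  root_base h alpha -> i \notin J -> 0 < t -> ~ cone_span h J (t *: h i).
Proof.
move=> [[offdiag diag _] _] iJ t0 /cone_spanP[c [c0 cJ /(congr1 (alpha i))]].
rewrite linearZ linear_sum /=; apply/eqP; rewrite gt_eqF//.
have := diag i; rewrite mxE => ->.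
apply: (@le_lt_trans _ _ 0); last exact: (mulr_gt0 t0 (ltr0n _ 2)).
apply: sumr_le0 => j _; rewrite linearZ /=.
have [->|ji] := eqVneq j i; first by rewrite cJ// scale0r.
apply: mulr_ge0_le0 => //.
by have := offdiag _ _ ji; rewrite !mxE => -[[/ltW]|[->]].
Qed.

Lemma facial_neg_supp h (alpha : 'I_n -> 'Hom(H, R^o)) J r :
  root_base h alpha -> facial h J -> relations h r ->
  pos_supp r \subset J -> neg_supp r \subset J.
Proof.
move=> rb /facialP face r0 /fintype.subsetP posJ.
apply/fintype.subsetP => i; rewrite inE => ri_lt0.
apply: contrapT => /negP iJ.
apply: (@root_base_notin_cone_span _ _ _ _ (- r ord0 i) rb iJ).
  by rewrite oppr_gt0.
pose negpart j := Num.max 0 (- r ord0 j).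
have negpart_ge0 j : 0 <= negpart j by rewrite le_max lexx.
(* The negative part of [r] splits into its [i]-th term and the rest; their sum equals the positive
   part, which lies in the cone of [J]. *)
apply: (face _ (\sum_(j | j != i) negpart j *: h j)).
- apply/cone_spanP; exists (fun j => if j == i then - r ord0 i else 0); split.
  + by move=> j; case: eqP => // _; rewrite oppr_ge0 ltW.
  + by move=> j; rewrite inE.
  + rewrite (bigD1 i)//= eqxx big1 ?addr0// => j /negbTE ->.
    by rewrite scale0r.
- apply/cone_spanP; exists (fun j => if j != i then negpart j else 0); split.
  + by move=> j; case: ifP.
  + by move=> j; rewrite inE.
  + by rewrite big_mkcond; apply: eq_bigr => j _; case: ifP; rewrite ?scale0r.
- apply/cone_spanP; exists (fun j => Num.max 0 (r ord0 j)); split.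
  + by move=> j; rewrite le_max lexx.
  + move=> j; apply: contraNeq => rj; apply: posJ; rewrite inE ltNge.
    by apply: contraNN rj => /max_idPl ->.
  + have -> : - r ord0 i = negpart i.
      by apply/esym/max_idPr; rewrite oppr_ge0 ltW.
    rewrite -(bigD1 i (P := xpredT) (F := fun j => negpart j *: h j))//=.
    (* Adding the vanishing sum of [r] turns the negative part into the positive one:
       [max 0 (- a) + a = max 0 a]. *)
    rewrite -[LHS]addr0 -[X in _ + X = _]r0 -big_split /=; apply: eq_bigr => j _.
    rewrite -scalerDl /negpart; congr (_ *: _).
    by rewrite addr_maxl add0r addNr maxC.
Qed.

Lemma facial_of_neg_supp h J :
  (forall r, relations h r -> neg_supp r \subset J -> pos_supp r \subset J) ->
  facial h J.
Proof.
move=> negpos; apply/facialP => x y /cone_spanP[c [c0 _ ->]].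
move=> /cone_spanP[d [d0 _ ->]] /cone_spanP[e [e0 eJ]].
rewrite -big_split /= => xyE.
apply/cone_spanP; exists c; split=> // i iJ.
(* Two expansions of [x + y] are subtracted. Off [J] the coefficient [e j] is 0, so [r] is
   nonnegative there. *)
pose r : 'rV[R]_n := \row_j (c j + d j - e j).
have r0 : relations h r.
  rewrite /relations /=; apply/eqP.
  under eq_bigr do rewrite mxE scalerBl scalerDl.
  by rewrite sumrB xyE subrr.
have negJ : neg_supp r \subset J.
  apply/fintype.subsetP => j; rewrite inE mxE; apply: contraLR => jJ.
  by rewrite eJ// subr0 -leNgt addr_ge0.
have /fintype.subsetP/(_ i) := negpos r r0 negJ.
rewrite inE mxE eJ// subr0 (negbTE iJ) => cd.
apply/eqP; rewrite eq_le c0 andbT leNgt; apply/negP => ci_gt0.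
by have /cd : 0 < c i + d i by rewrite ltr_wpDr.
Qed.

End Cones.

Local Close Scope classical_set_scope.

Theorem corollary3p31 (R : realType) (n : nat) (n_ge1 : (1 <= n)%N)
    (H : vectType R) (h : 'I_n -> H) (alpha : 'I_n -> 'Hom(H, R^o))
    (rb : root_base h alpha) (J : {set 'I_n}) :
  [<-> (* (i) *) facial h J;
       (* (ii) *) forall r : 'rV[R]_n, relations h r ->
         (pos_supp r \subset J /\ neg_supp r \subset J) \/
         (~~ (pos_supp r \subset J) /\ ~~ (neg_supp r \subset J));
       (* (iii) *) forall r : 'rV[R]_n, relations h r ->
         pos_supp r \subset J -> neg_supp r \subset J;
       (* (iv) *) forall r : 'rV[R]_n, relations h r ->
         neg_supp r \subset J -> pos_supp r \subset J].
Proof.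
tfae.
- move=> facJ r r0.
  have posneg := facial_neg_supp _ _ _ _ rb facJ r0.
  (* Passing to [- r] exchanges the two supports and gives the reverse implication. *)
  have negpos := facial_neg_supp _ _ _ _ rb facJ (relationsN _ _ r0).
  rewrite pos_suppN neg_suppN in negpos.
  case: (boolP (pos_supp r \subset J)) => [/posneg|nposJ]; first by left.
  by right; split=> //; apply: contraNN nposJ.
- by move=> dich r /dich[[]|[/negbTE ->]].
- by move=> posneg r /relationsN/posneg; rewrite pos_suppN neg_suppN.
- exact: facial_of_neg_supp.
Qed.
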